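(* Let $1\le p\le n$ and let $\rho,\sigma\in\mathcal{DORP}_n$ be elements with $|\mathrm{Im}\,\rho|=|\mathrm{Im}\,\sigma|=p$, written as $$\rho=\begin{pmatrix}A_1&\cdots&A_p\\ a_1&\cdots&a_p\end{pmatrix},\qquad \sigma=\begin{pmatrix}B_1&\cdots&B_p\\ b_1&\cdots&b_p\end{pmatrix}.$$ Then $\rho\,\mathcal{L}\,\sigma$ in the monoid $\mathcal{DORP}_n$ if and only if $a_i=b_i$ and $\min a_i\rho^{-1}=\min b_i\sigma^{-1}$ for all $1\le i\le p$.
   Context: Let $[n]=\{1,\dots,n\}$ with its usual order. A partial transformation of $[n]$ is a function $\rho$ whose domain $\mathrm{Dom}\,\rho$ and image $\mathrm{Im}\,\rho$ are subsets of $[n]$ (the empty map is allowed). Maps are written on the right and composed left to right: $x(\rho\sigma)=(x\rho)\sigma$. $\rho$ is isotone if $x\le y$ implies $x\rho\le y\rho$ for all $x,y\in\mathrm{Dom}\,\rho$; antitone if $x\le y$ implies $x\rho\ge y\rho$; monotone if isotone or antitone; decreasing if $x\rho\le x$ for all $x\in\mathrm{Dom}\,\rho$. $\mathcal{DORP}_n$ is the monoid, under composition, of all monotone and decreasing partial transformations of $[n]$. In the two-line notation for $\rho$, the sets $A_1<\cdots<A_p$ are the classes of the kernel relation $\{(x,y)\in\mathrm{Dom}\,\rho\times\mathrm{Dom}\,\rho: x\rho=y\rho\}$, listed in increasing order ($A_i<A_j$ means every element of $A_i$ is less than every element of $A_j$), and $a_i$ is the common image of the elements of $A_i$; similarly for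 $\sigma$. The set $a\rho^{-1}$ is the preimage of $a$ under $\rho$. $\mathcal{L}$ is the usual Green's relation: $g\,\mathcal{L}\,h$ in $S$ iff $S^1g=S^1h$. *)

(* Defs.v *)
From HB Require Import structures.
From mathcomp Require Import all_boot.

Set Implicit Arguments.
Unset Strict Implicit.
Unset Printing Implicit Defensive.

(* Green's L relation; [x \in left_ideal1 g] reads x \in S^1 g. *)
Section Green.
Variable S : semigroupType.
Implicit Types g h x : S.

Definition left_ideal1 g x : Prop := x = g \/ exists s : S, x = (s * g)%g.

Definition greenL g h : Prop := forall x, left_ideal1 g x <-> left_ideal1 h x.

End Green.

(* Partial transformations of the chain [n], modelled by 'I_n; [None] means
   undefined. *)
Definition ptrans (n : nat) := {ffun 'I_n -> option 'I_n}.
HB.instance Definition _ n := Finite.on (ptrans n).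

Section PartialTransformations.
Variable n : nat.
Implicit Types rho sigma tau : ptrans n.

(* Maps act on the right: x (rho sigma) = (x rho) sigma. *)
Definition pcomp rho sigma : ptrans n := [ffun x => obind sigma (rho x)].

Definition pid : ptrans n := [ffun x => Some x].

Lemma pcompA : associative pcomp.
Proof.
by move=> r s t; apply/ffunP => x; rewrite !ffunE; case: (r x) => //= y; rewrite ffunE.
Qed.

Lemma pcomp1r : left_id pid pcomp.
Proof. by move=> r; apply/ffunP => x; rewrite !ffunE. Qed.

Lemma pcompr1 : right_id pid pcomp.
Proof.
by move=> r; apply/ffunP => x; rewrite !ffunE; case: (r x) => //= y; rewrite ffunE.
Qed.

HB.instance Definition _ := isMonoid.Build (ptrans n) pcompA pcomp1r pcompr1.

Definition Dom rho : {set 'I_n} := [set x | rho x].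

Definition preimg rho (a : 'I_n) : {set 'I_n} := [set x | rho x == Some a].

Definition Im rho : {set 'I_n} := [set a | [exists x, rho x == Some a]].

Definition isotone rho : bool :=
  [forall x, forall y, forall u, forall v,
    [&& rho x == Some u, rho y == Some v & x <= y] ==> (u <= v)].

Definition antitone rho : bool :=
  [forall x, forall y, forall u, forall v,
    [&& rho x == Some u, rho y == Some v & x <= y] ==> (v <= u)].

Definition monotone rho : bool := isotone rho || antitone rho.

Definition decreasing rho : bool :=
  [forall x, forall u, (rho x == Some u) ==> (u <= x)].

Definition dorp : {pred ptrans n} := fun rho => monotone rho && decreasing rho.

Lemma isotoneP rho :
  reflect (forall x y u v, rho x = Some u -> rho y = Some v -> x <= y -> u <= v)
          (isotone rho).
Proof.
apply: (iffP idP) => [+ x y u v hu hv hxy | h].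
  move=> /forallP/(_ x)/forallP/(_ y)/forallP/(_ u)/forallP/(_ v).
  by rewrite hu hv hxy !eqxx.
apply/forallP=> x; apply/forallP=> y; apply/forallP=> u; apply/forallP=> v.
by apply/implyP=> /and3P[/eqP hu /eqP hv]; apply: h.
Qed.

Lemma antitoneP rho :
  reflect (forall x y u v, rho x = Some u -> rho y = Some v -> x <= y -> v <= u)
          (antitone rho).
Proof.
apply: (iffP idP) => [+ x y u v hu hv hxy | h].
  move=> /forallP/(_ x)/forallP/(_ y)/forallP/(_ u)/forallP/(_ v).
  by rewrite hu hv hxy !eqxx.
apply/forallP=> x; apply/forallP=> y; apply/forallP=> u; apply/forallP=> v.
by apply/implyP=> /and3P[/eqP hu /eqP hv]; apply: h.
Qed.

Lemma decreasingP rho :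
  reflect (forall x u, rho x = Some u -> u <= x) (decreasing rho).
Proof.
apply: (iffP idP) => [+ x u hu | h].
  by move=> /forallP/(_ x)/forallP/(_ u); rewrite hu eqxx.
by apply/forallP=> x; apply/forallP=> u; apply/implyP=> /eqP; apply: h.
Qed.

Lemma pcomp_Some rho sigma x v :
  (rho * sigma)%g x = Some v -> exists2 u, rho x = Some u & sigma u = Some v.
Proof. by rewrite /mul/= ffunE; case: (rho x) => //= u; exists u. Qed.

Lemma dorp_monoid_closed : monoid_closed dorp.
Proof.
split.
  apply/andP; split.
    by apply/orP; left; apply/isotoneP => x y u v; rewrite !ffunE => -[<-] [<-].
  by apply/decreasingP => x u; rewrite ffunE => -[<-].
move=> r s /andP[mr /decreasingP dr] /andP[ms /decreasingP ds].
apply/andP; split; last first.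
  by apply/decreasingP => x v /pcomp_Some[u /dr ux /ds vu]; apply: leq_trans ux.
case/orP: mr => [/isotoneP|/antitoneP] hr; case/orP: ms => [/isotoneP|/antitoneP] hs;
  apply/orP; [left; apply/isotoneP|right; apply/antitoneP
             |right; apply/antitoneP|left; apply/isotoneP];
  move=> x y u v /pcomp_Some[u' ru su] /pcomp_Some[v' rv sv] xy.
- exact: hs su sv (hr _ _ _ _ ru rv xy).
- exact: hs su sv (hr _ _ _ _ ru rv xy).
- exact: hs sv su (hr _ _ _ _ ru rv xy).
- exact: hs sv su (hr _ _ _ _ ru rv xy).
Qed.

(* The kernel relation of rho, considered on Dom rho. *)
Definition pker rho : rel 'I_n := [rel x y | rho x == rho y].

(* rho = ( A_1 ... A_p / a_1 ... a_p ) with A_1 < ... < A_p. *)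
Definition two_line rho (p : nat) (A : 'I_p -> {set 'I_n}) (a : 'I_p -> 'I_n) :
    Prop :=
  [/\ [set A i | i : 'I_p] = equivalence_partition (pker rho) (Dom rho),
      forall i j : 'I_p, i < j -> forall x y, x \in A i -> y \in A j -> x < y
    & forall (i : 'I_p) x, x \in A i -> rho x = Some (a i)].

(* The least element of X; the junk value for X = set0 is n. *)
Definition setmin (X : {set 'I_n}) : nat := \big[minn/n]_(x in X) x.

End PartialTransformations.

(* The monoid DORP_n, with the multiplication inherited from [ptrans n]. *)
Record DORP (n : nat) := MkDORP { dorp_val :> ptrans n; _ : dorp_val \in @dorp n }.
HB.instance Definition _ n := [isSub for @dorp_val n].
HB.instance Definition _ n := [Finite of DORP n by <:].
HB.instance Definition _ n :=
  SubChoice_isSubMonoid.Build (ptrans n) _ (DORP n) (@dorp_monoid_closed n).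

(* Main.v *)
Require Import Defs.
From mathcomp Require Import all_boot all_order.

Import Order.TTheory.

Set Implicit Arguments.
Unset Strict Implicit.
Unset Printing Implicit Defensive.

(** Without indexing the kernel classes, [rho L sigma] says that [rho] and
[sigma] have the same image and that each point of it has the same least
preimage under both.  If [rho = s sigma] with [s] decreasing, then [s] maps the
least preimage of [u] under [rho] to a preimage of [u] under [sigma] that is not
larger.  Conversely, sending [x] to the least preimage of [x rho] under [sigma]
is decreasing and isotone because that point is also the least preimage of
[x rho] under [rho].  Finally, the least preimages increase strictly with the
index of the class, so they determine the order in which the two-line notation
lists the image. *)

(** The alternative [x = g] in [left_ideal1] is absorbed by the multiplier [1], and mutual left
    divisibility passes to all multiples by associativity. *)
Lemma greenL_mulP (S : monoidType) (g h : S) :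
  greenL g h <-> (exists s, g = s * h)%g /\ (exists s, h = s * g)%g.
Proof.
split=> [L | [[s gE] [t hE]] x].
  split.
    have [->|//] := (L g).1 (or_introl erefl).
    by exists 1%g; rewrite mul1g.
  have [->|//] := (L h).2 (or_introl erefl).
  by exists 1%g; rewrite mul1g.
split=> -[->|[r ->]]; right.
- by exists s.
- by exists (r * s)%g; rewrite -mulgA -gE.
- by exists t.
- by exists (r * t)%g; rewrite -mulgA -hE.
Qed.

Lemma setmin_le (n : nat) (X : {set 'I_n}) (x : 'I_n) : x \in X -> setmin X <= x.
Proof. exact: (@bigmin_le_cond _ _ _ n x (mem X) val). Qed.

Lemma setmin_mem (n : nat) (X : {set 'I_n}) (x : 'I_n) :
  x \in X -> exists2 y, y \in X & setmin X = y.
Proof.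
move=> xX.
have [|y yX yE] := @eq_bigmin _ _ _ n x (mem X) val xX.
  (* The default value [n] exceeds every element of ['I_n], so the minimum over a nonempty set is
     attained. *)
  by move=> i _; apply: ltnW (ltn_ord i).
by exists y.
Qed.

Lemma setmin_preimg_le {n : nat} {rho : ptrans n} {x u : 'I_n} :
  rho x = Some u -> setmin (preimg rho u) <= x.
Proof. by move=> xu; apply: setmin_le; rewrite inE xu. Qed.

Lemma setmin_preimg_Im {n : nat} {rho : ptrans n} {u : 'I_n} :
  u \in Im rho -> exists2 x, rho x = Some u & setmin (preimg rho u) = x.
Proof.
rewrite inE => /existsP[x xu].
have [|y + yE] := @setmin_mem n (preimg rho u) x; first by rewrite inE.
by rewrite inE => /eqP yu; exists y.
Qed.

Lemma mem_Im {n : nat} {rho : ptrans n} {x u : 'I_n} : rho x = Some u -> u \in Im rho.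
Proof. by move=> xu; rewrite inE; apply/existsP; exists x; rewrite xu. Qed.

Lemma monotone_between (n : nat) (rho : ptrans n) (x y z u v : 'I_n) :
  monotone rho -> rho x = Some u -> rho y = Some v -> rho z = Some u ->
  x <= y <= z -> v = u.
Proof.
move=> mr xu yv zu /andP[xy yz]; apply/val_inj/anti_leq/andP.
by case/orP: mr => [/isotoneP|/antitoneP] r;
  rewrite (r _ _ _ _ xu yv xy) (r _ _ _ _ yv zu yz).
Qed.

(** Let [z] be the least preimage of [v]. Either [x <= z], or [x] lies between [z] and [y], and
    convexity of kernel classes forces [u = v]. This covers antitone [rho] too, so the left factor
    built below is always isotone. *)
Lemma leq_setmin_preimg (n : nat) (rho : ptrans n) (x y u v : 'I_n) :
  monotone rho -> rho x = Some u -> rho y = Some v -> x <= y ->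
  setmin (preimg rho u) <= setmin (preimg rho v).
Proof.
move=> mr xu yv xy; have [z zv ->] := setmin_preimg_Im (mem_Im yv).
case: (leqP x z) => [|/ltnW zx]; first exact: leq_trans (setmin_preimg_le xu).
have uv : u = v by apply: monotone_between mr zv xu yv _; rewrite zx.
by apply: setmin_preimg_le; rewrite uv.
Qed.

Lemma Im_mul_subset (n : nat) (rho sigma : ptrans n) :
  Im (rho * sigma)%g \subset Im sigma.
Proof.
by apply/subsetP => u; rewrite inE => /existsP[x /eqP/pcomp_Some[y _ /mem_Im]].
Qed.

Lemma setmin_preimg_mul (n : nat) (s sigma : ptrans n) (u : 'I_n) :
  decreasing s -> u \in Im (s * sigma)%g ->
  setmin (preimg sigma u) <= setmin (preimg (s * sigma)%g u).
Proof.
move=> /decreasingP ds /setmin_preimg_Im[x /pcomp_Some[y xy yu] ->].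
exact: leq_trans (setmin_preimg_le yu) (ds _ _ xy).
Qed.

Lemma DORP_left_factor (n : nat) (rho sigma : DORP n) :
  Im rho \subset Im sigma ->
  {in Im rho, forall u, setmin (preimg rho u) = setmin (preimg sigma u)} ->
  exists s : DORP n, rho = (s * sigma)%g.
Proof.
move=> sub minE.
have mr : monotone rho by case: rho {sub minE} => r /= /andP[].
(* Minima are taken under [rho], which makes [s] decreasing and isotone at once; their equality with
   those under [sigma] enters when [sigma] is applied. [insub] casts the minimum back to ['I_n]; it
   succeeds here because [u] has a preimage. *)
pose s : ptrans n := [ffun x => obind (fun u => insub (setmin (preimg rho u))) (dorp_val rho x)].
have sP x y : s x = Some y -> exists2 u, dorp_val rho x = Some u & setmin (preimg rho u) = y.
  rewrite ffunE; case: (dorp_val rho x) => //= u; case: insubP => // z _ zE [<-].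
  by exists u.
have sD : s \in @dorp n.
  apply/andP; split; last first.
    by apply/decreasingP => x y /sP[u xu <-]; apply: setmin_preimg_le.
  apply/orP; left; apply/isotoneP => x y x' y' /sP[u xu <-] /sP[v yv <-].
  exact: leq_setmin_preimg.
exists (MkDORP sD); apply: val_inj; apply/ffunP => x.
rewrite [RHS]ffunE /= ffunE; case xu: (dorp_val rho x) => [u|//] /=.
have uI := mem_Im xu; rewrite (minE _ uI).
have [y yu ->] := setmin_preimg_Im (subsetP sub _ uI).
by rewrite valK /= yu.
Qed.

Lemma greenL_DORP (n : nat) (rho sigma : DORP n) :
  greenL rho sigma <->
  Im rho = Im sigma /\
  {in Im rho, forall u, setmin (preimg rho u) = setmin (preimg sigma u)}.
Proof.
have decr (s : DORP n) : decreasing s by case: s => s /= /andP[].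
have left_mul (g h s : DORP n) : g = (s * h)%g ->
    Im g \subset Im h /\
    {in Im g, forall u, setmin (preimg h u) <= setmin (preimg g u)}.
  move=> ->; split=> [|u]; first exact: Im_mul_subset.
  exact: setmin_preimg_mul (decr s).
split=> [/greenL_mulP[[s /left_mul[sub1 le1]] [t /left_mul[sub2 le2]]] | [ImE minE]].
  split=> [|u uI]; first by apply/eqP; rewrite eqEsubset sub1.
  by apply: anti_leq; rewrite le1 // le2 // (subsetP sub1).
apply/greenL_mulP; split; apply: DORP_left_factor => //.
- by rewrite ImE.
- by rewrite ImE.
- by move=> u; rewrite -ImE => uI; rewrite minE.
Qed.

Section TwoLine.
Variables (n p : nat) (rho : ptrans n) (A : 'I_p -> {set 'I_n}) (a : 'I_p -> 'I_n).
Hypothesis hA : two_line rho A a.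

Lemma two_line_block (i : 'I_p) :
  exists2 x, rho x = Some (a i) & A i = [set y in Dom rho | pker rho x y].
Proof.
have [part _ val_A] := hA.
have : A i \in equivalence_partition (pker rho) (Dom rho) by rewrite -part imset_f.
case/imsetP=> x; rewrite inE => xD AE; exists x => //.
by apply: val_A; rewrite AE !inE xD /pker /= eqxx.
Qed.

Lemma two_line_class (i : 'I_p) : A i = preimg rho (a i).
Proof.
have [x xi ->] := two_line_block i.
apply/setP => y; rewrite !inE /pker /= xi eq_sym andb_idl //.
by move/eqP->.
Qed.

Lemma two_line_Im : Im rho =i codom a.
Proof.
have [part _ val_A] := hA.
move=> u; apply/idP/codomP => [|[i ->]].
  rewrite inE => /existsP[x /eqP xu].
  have : [set y in Dom rho | pker rho x y] \in [set A i | i : 'I_p].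
    by rewrite part; apply: imset_f; rewrite inE xu.
  case/imsetP=> i _ AE; exists i.
  by apply: Some_inj; rewrite -xu; apply: val_A; rewrite -AE !inE xu /pker /= xu eqxx.
by have [x /mem_Im] := two_line_block i.
Qed.

(** The two minima are attained inside the blocks [A i] and [A j], which are ordered whether [rho]
    is isotone or antitone. *)
Lemma two_line_setmin_lt (i j : 'I_p) :
  i < j -> setmin (preimg rho (a i)) < setmin (preimg rho (a j)).
Proof.
have [_ ltA _] := hA => ij.
have memI k : a k \in Im rho by rewrite two_line_Im codom_f.
have [x xi ->] := setmin_preimg_Im (memI i).
have [y yj ->] := setmin_preimg_Im (memI j).
by apply: (ltA _ _ ij); rewrite two_line_class inE ?xi ?yj.
Qed.

(** The free key [m] allows the image lists of two maps to be sorted by one common order. *)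
Lemma two_line_sorted (m : 'I_n -> nat) :
  {in Im rho, forall u, setmin (preimg rho u) = m u} ->
  sorted (relpre m ltn) (codom a).
Proof.
move=> mE; rewrite codomE sorted_map.
have : sorted (relpre val ltn) (enum 'I_p).
  by rewrite -sorted_map val_enum_ord iota_ltn_sorted.
by apply: sub_sorted => i j /two_line_setmin_lt /=; rewrite !mE ?two_line_Im ?codom_f.
Qed.

End TwoLine.

Theorem theorem2p1 (n p : nat) (hp : 1 <= p <= n) (rho sigma : DORP n)
    (hrho : #|Im rho| = p) (hsigma : #|Im sigma| = p)
    (A B : 'I_p -> {set 'I_n}) (a b : 'I_p -> 'I_n)
    (hA : two_line rho A a) (hB : two_line sigma B b) :
  greenL rho sigma <->
  (forall i : 'I_p,
     a i = b i /\ setmin (preimg rho (a i)) = setmin (preimg sigma (b i))).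
Proof.
split=> [/greenL_DORP[ImE minE] | eq_ab].
  have codomE : codom a = codom b.
    pose m u := setmin (preimg sigma u).
    (* Two lists with the same members, both strictly sorted by the key [m], coincide; this aligns
       the indices of [a] and [b]. *)
    apply: (@irr_sorted_eq _ (relpre m ltn)).
    - by move=> x y z; apply: ltn_trans.
    - by move=> x; apply: ltnn.
    - exact: (two_line_sorted (m := m) hA minE).
    - exact: (two_line_sorted hB (m := m) (fun _ _ => erefl)).
    - by move=> u; rewrite -(two_line_Im hA) ImE (two_line_Im hB).
  have eq_a i : a i = b i by apply: (eq_in_map a b _).2 codomE _ (mem_enum _ i).
  by move=> i; rewrite -eq_a minE // (two_line_Im hA) codom_f.
apply/greenL_DORP; split=> [|u].
  apply/setP => u; rewrite (two_line_Im hA) (two_line_Im hB).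
  by rewrite (eq_codom (fun i => (eq_ab i).1)).
rewrite (two_line_Im hA) => /codomP[i ->].
by have [abE ->] := eq_ab i; rewrite -abE.
Qed.
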